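(* There exists a universal constant $C > 0$ such that the following holds. Let $G$ be a connected $n$-vertex $d$-regular $\lambda$-expander with $d \ge 1$, and let $k \ge 1$ be an integer. Then for any $v \in V(G)$ and any integer $g$ with $d \le g \le n/2$, $$|\mathcal{H}_k(v,g)| \le \exp\left( \frac{Cg}{d} \max\left\{ k \log(4\lambda/\sqrt{d}) \log d,\ \frac{\lambda^2}{d} \right\} \right).$$
   Context: All graphs are finite and simple; $\log$ denotes $\log_2$ and $\exp(x)=e^x$. For a real number $\lambda$, an $n$-vertex $d$-regular graph $G$ is called a $\lambda$-expander if for all $S, T \subseteq V(G)$, $$\left| e(S,T) - \frac{d}{n}|S||T| \right| \le \lambda \sqrt{|S||T|},$$ where $e(S,T)$ is the number of edges with one endpoint in $S$ and the other in $T$, counted twice if both endpoints lie in $S \cap T$ (i.e. the number of ordered pairs $(s,t) \in S \times T$ with $\{s,t\} \in E(G)$). For $X \subseteq V(G)$, $N(X) = \{v \in V(G) : \exists u \in X,\ \{u,v\} \in E(G)\}$. For $k \ge 1$, $G^k$ is the graph on $V(G)$ in which two distinct vertices are adjacent iff their distance in $G$ is at most $k$; $X \subseteq V(G)$ is $k$-linked if the induced subgraph $G^k[X]$ is connected. Define $$\mathcal{H}_k(v,g) = \{ X \subseteq V(G) : X \text{ is } k\text{-linked in } G,\ v \in X,\ |N(X)| = g \}.$$ *)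

(* Defs.v *)
From HB Require Import structures.
From mathcomp Require Import all_boot all_order all_algebra.
From mathcomp Require Import reals sequences exp.
Set Implicit Arguments.
Unset Strict Implicit.
Unset Printing Implicit Defensive.
Import Order.TTheory GRing.Theory Num.Theory.
Local Open Scope ring_scope.

Record sgraph := SGraph {
  vertex :> finType;
  adj : rel vertex;
  adj_sym : symmetric adj;
  adj_irrefl : irreflexive adj
}.

Definition log2 (R : realType) (x : R) : R := ln x / ln 2.

Section Graph.
Variable G : sgraph.
Implicit Types (X S T : {set G}) (x y v : G) (d k g m : nat).

Definition gconnected : Prop := forall x y, connect (@adj G) x y.

Definition regular d : Prop := forall x, #|[set y | adj x y]| = d.

Definition edge_count S T : nat :=
  #|[set p : G * G | [&& p.1 \in S, p.2 \in T & adj p.1 p.2]]|.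

Definition expander (R : realType) d (lambda : R) : Prop :=
  regular d /\
  forall S T,
    `|(edge_count S T)%:R - d%:R / #|G|%:R * #|S|%:R * #|T|%:R|
      <= lambda * Num.sqrt (#|S|%:R * #|T|%:R).

Definition nbhd X : {set G} := [set v | [exists u in X, adj u v]].

Definition walk m x y : bool :=
  [exists p : m.-tuple G, path (@adj G) x p && (last x p == y)].

(* Least length of a walk from x to y. If there is no walk, the value is the
   junk value #|G|; see gdistP for the connected case. *)
Definition gdist x y : nat := find (fun m => walk m x y) (iota 0 #|G|).

Lemma gdistP x y : connect (@adj G) x y ->
  walk (gdist x y) x y /\ forall m, walk m x y -> (gdist x y <= m)%N.
Proof.
move=> /connectP[p0 p0P ->]; case/shortenP: p0P => p pP pU _.
set z := last x p.
have wp : walk (size p) x z.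
  by apply/existsP; exists (in_tuple p); rewrite /= pP eqxx.
have sp : (size p < #|G|)%N.
  by rewrite -[(size p).+1]/(size (x :: p)) -(card_uniqP pU) max_card.
have hP : has (fun m => walk m x z) (iota 0 #|G|).
  by apply/hasP; exists (size p) => //; rewrite mem_iota.
have lt_d : (gdist x z < #|G|)%N by rewrite -[X in (_ < X)%N](size_iota 0) -has_find.
split; first by move: (nth_find 0%N hP); rewrite nth_iota.
move=> m wm; rewrite leqNgt; apply/negP => lt_m.
by move: (before_find 0%N lt_m); rewrite nth_iota ?wm // (ltn_trans lt_m).
Qed.

Definition power_adj k : rel G :=
  [rel x y | [&& x != y, connect (@adj G) x y & (gdist x y <= k)%N]].

Definition linked k X : bool :=
  [forall x in X, forall y in X,
    connect [rel a b | [&& a \in X, b \in X & power_adj k a b]] x y].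

Definition Hfam k v g : {set {set G}} :=
  [set X | [&& linked k X, v \in X & #|nbhd X| == g]].

End Graph.

(* Main.v *)
Require Import Defs.
From HB Require Import structures.
From mathcomp Require Import all_boot all_order all_algebra.
From mathcomp Require Import reals sequences exp.
From mathcomp Require Import zify ring lra.
Set Implicit Arguments.
Unset Strict Implicit.
Unset Printing Implicit Defensive.
Import Order.TTheory GRing.Theory Num.Theory.
Local Open Scope ring_scope.

(** Each X in the family is encoded by a small subset T of X together with the
    choice of X among the subsets of a small set W determined by T.

    Take T in X maximal subject to v in T and d|T| <= 4|N(T)|. Then
    |T| <= 4g/d, and by maximality no vertex of X has more than d/4 neighbours
    outside N(T) (exists_skeleton). So X lies in the set W of vertices with at
    least 3d/4 neighbours in N(T).

    The set W is small (card_captured): there are at least (3d/4)|W| edges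
    from W to N(T), while |N(T)| <= g <= n/2 lets the density term of the mixing
    inequality account for only (d/2)|W| of them. The remaining (d/4)|W| are at
    most lambda sqrt(|W| g), whence |W| <= 16 lambda^2 g / d^2. Choosing X inside
    W therefore costs a factor 2^(16 lambda^2 g / d^2).

    The set T is cheap to name: every vertex of X is within distance 2 of T, so
    T inherits linkedness from X with k + 4 in place of k (skeleton_linked). A
    traversal of a spanning tree shows that T is the set of vertices of a walk
    from v with at most 8g/d steps of length at most k + 4
    (covering_closed_walk), and there are at most (d+1)^((k+4) 8g/d) such walks.

    The product of the two counts is card_Hfam_le. Testing the mixing inequality
    on a vertex and its neighbourhood gives lambda >= sqrt(d)/2
    (sqrt_degree_le), that is log(4 lambda / sqrt d) >= 1, so for d >= 2 the
    exponent of order k (g/d) log d coming from T is bounded, up to a constant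
    factor, by the first term of the maximum, and the one from W by the second. For d = 1 the first
    term vanishes, but then G is a single edge. *)

(** * Counting walks and covering by walks *)

Fixpoint trails (T : finType) (r : T -> {set T}) (m : nat) (x : T) : seq (seq T) :=
  if m is m'.+1 then [seq y :: s | y <- enum (r x), s <- trails r m' y]
  else [:: [::]].

Lemma mem_trails (T : finType) (r : T -> {set T}) (x : T) (p : seq T) :
  path (fun a b => b \in r a) x p -> p \in trails r (size p) x.
Proof.
elim: p x => [|y p IHp] x //= /andP[xy /IHp pP].
by apply/allpairsPdep; exists y, p; rewrite mem_enum.
Qed.

Lemma size_trails (T : finType) (r : T -> {set T}) (D m : nat) (x : T) :
  (forall y, #|r y| <= D)%N -> (size (trails r m x) <= D ^ m)%N.
Proof.
move=> rD; elim: m x => [|m IHm] x //=.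
rewrite size_allpairs_dep sumnE big_map expnS big_enum /=.
apply: leq_trans (leq_mul (rD x) (leqnn _)).
by rewrite -sum_nat_const; apply: leq_sum => y _; apply: IHm.
Qed.

(** Union bound: an index i counts only when W i has at most w elements, so
    the list s may contain indices for which nothing is known about W i. *)
Lemma card_cover (T : finType) (I : eqType) (H : {set {set T}}) (s : seq I)
    (W : I -> {set T}) (w : nat) :
  (forall X, X \in H -> exists2 i, i \in s & X \subset W i /\ (#|W i| <= w)%N) ->
  (#|H| <= size s * 2 ^ w)%N.
Proof.
move=> HW.
pose s' := [seq i <- s | #|W i| <= w]%N.
have sub : H \subset [pred X | X \in flatten [seq enum (powerset (W i)) | i <- s']].
  apply/subsetP => X /HW[i si [XW Ww]]; rewrite inE.
  apply/flattenP; exists (enum (powerset (W i))).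
    by apply/mapP; exists i; rewrite ?mem_filter ?Ww.
  by rewrite mem_enum inE.
apply: leq_trans (subset_leq_card sub) _.
apply: leq_trans (card_size _) _.
rewrite size_flatten /shape -map_comp sumnE big_map big_filter.
have -> : (size s * 2 ^ w)%N = (\sum_(i <- s) 2 ^ w)%N.
  by rewrite big_const_seq count_predT iter_addn_0 mulnC.
rewrite [leqRHS](bigID (fun i => #|W i| <= w)%N) /=.
apply: leq_trans (leq_addr _ _).
by apply: leq_sum => i Wi; rewrite -cardE card_powerset leq_exp2l.
Qed.

(** A depth-first traversal of a spanning tree of A crosses each of its |A| - 1
    edges twice. The hypothesis on B is connectedness of A in cut form, which is
    what extending a partial traversal uses. *)
Lemma covering_closed_walk (T : finType) (e : rel T) (A : {set T}) (v : T) :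
  symmetric e -> v \in A ->
  (forall B : {set T}, v \in B -> B \proper A -> exists2 a, a \in B & exists2 b, b \in A :\: B & e a b) ->
  exists p, [/\ path e v p, [set x in v :: p] = A & size p = (#|A|.-1).*2].
Proof.
move=> esym vA ext.
have grow n : (n < #|A|)%N -> exists p, [/\ path e v p, [set x in v :: p] \subset A,
    #|[set x in v :: p]| = n.+1 & size p = n.*2].
  elim: n => [|n IHn] ltn.
    exists [::]; split=> //; last by rewrite set_seq1 cards1.
    by rewrite set_seq1 sub1set.
  have [p [pP pA pn sp]] := IHn (ltnW ltn).
  set B := [set x in v :: p] in pA pn.
  have BA : B \proper A by rewrite properEcard pA pn.
  have vB : v \in B by rewrite inE mem_head.
  have [a aB [b]] := ext _ vB BA.
  rewrite inE => /andP[bB bA] ab.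
  have ap : a \in v :: p by move: aB; rewrite inE.
  case/splitPl pE: {1}p / ap => [p1 p2 la].
  (* Insert the detour a, b, a at a visit of a. *)
  exists (p1 ++ [:: b, a & p2]).
  have sE : [set x in v :: p1 ++ [:: b, a & p2]] = b |: B.
    apply/setP=> x; rewrite /B pE !inE !mem_cat !inE.
    have -> : (x == a) = (x == a) && ((x == v) || (x \in p1)).
      case: eqP => //= ->; have := mem_last v p1.
      by rewrite la inE => ->.
    by do ![case: (_ == _) => //=]; case: (_ \in p1) => //=; rewrite ?orbT.
  split.
  - move: pP; rewrite pE !cat_path la /= => /andP[-> ->].
    by rewrite ab esym ab.
  - by rewrite sE subUset sub1set bA pA.
  - by rewrite sE cardsU1 bB pn.
  - by rewrite size_cat /= doubleS -sp pE size_cat !addnS.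
have A0 : (0 < #|A|)%N by apply/card_gt0P; exists v.
have [|p [pP pA pn sp]] := grow #|A|.-1; first by rewrite prednK.
exists p; split=> //; apply/eqP.
by rewrite eqEcard pA pn prednK ?leqnn.
Qed.

(** * Neighbourhoods and balls *)

Definition ball (G : sgraph) (m : nat) (x : G) : {set G} :=
  iter m (fun S => S :|: nbhd S) [set x].

Lemma nbhdP (G : sgraph) (X : {set G}) (v : G) :
  reflect (exists2 u, u \in X & adj u v) (v \in nbhd X).
Proof. by rewrite inE; apply: (iffP exists_inP). Qed.

Lemma nbhdS (G : sgraph) (X Y : {set G}) : X \subset Y -> nbhd X \subset nbhd Y.
Proof.
move=> /subsetP XY; apply/subsetP => v /nbhdP[u uX uv].
by apply/nbhdP; exists u => //; apply: XY.
Qed.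

Lemma nbhdU (G : sgraph) (X Y : {set G}) : nbhd (X :|: Y) = nbhd X :|: nbhd Y.
Proof.
apply/eqP; rewrite eqEsubset subUset !nbhdS ?subsetUl ?subsetUr // !andbT.
apply/subsetP => v /nbhdP[u]; rewrite !in_setU => /orP[] uX uv; apply/orP.
  by left; apply/nbhdP; exists u.
by right; apply/nbhdP; exists u.
Qed.

Lemma nbhd1 (G : sgraph) (x : G) : nbhd [set x] = [set y | adj x y].
Proof.
apply/setP=> y; rewrite [RHS]inE; apply/nbhdP/idP => [[u /set1P->]//|xy].
by exists x; rewrite ?set11.
Qed.

Lemma card_nbhd (G : sgraph) (d : nat) (X : {set G}) :
  regular G d -> (#|nbhd X| <= d * #|X|)%N.
Proof.
move=> rG; have -> : nbhd X = \bigcup_(x in X) nbhd [set x].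
  apply/setP=> y; apply/nbhdP/bigcupP => [] [x xX xy]; exists x => //.
    by rewrite nbhd1 inE.
  by move: xy; rewrite nbhd1 inE.
apply: (@leq_trans (\sum_(x in X) #|nbhd [set x]|)%N).
  apply: (big_ind2 (fun (S : {set G}) m => #|S| <= m)%N) => [|S i S' j Si S'j|//].
    by rewrite cards0.
  by apply: leq_trans (leq_card_setU _ _) (leq_add Si S'j).
rewrite mulnC -sum_nat_const; apply: leq_sum => x _.
by rewrite nbhd1 rG.
Qed.

Lemma ball0 (G : sgraph) (x : G) : ball 0 x = [set x].
Proof. by []. Qed.

Lemma ballS (G : sgraph) (m : nat) (x : G) :
  ball m.+1 x = ball m x :|: nbhd (ball m x).
Proof. by []. Qed.

Lemma card_ball (G : sgraph) (d m : nat) (x : G) :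
  regular G d -> (#|ball m x| <= d.+1 ^ m)%N.
Proof.
move=> rG; elim: m => [|m IHm]; first by rewrite /ball /= cards1.
rewrite ballS expnS; apply: leq_trans (leq_card_setU _ _) _.
apply: leq_trans (leq_add (leqnn _) (card_nbhd _ rG)) _.
by rewrite -mulSn leq_mul2l IHm orbT.
Qed.

Lemma ball_center (G : sgraph) (m : nat) (x : G) : x \in ball m x.
Proof. by elim: m => [|m IHm]; rewrite ?set11 // ballS inE IHm. Qed.

Lemma ball_trans (G : sgraph) (i j : nat) (x y z : G) :
  y \in ball i x -> z \in ball j y -> z \in ball (i + j) x.
Proof.
move=> xy; elim: j z => [|j IHj] z; first by rewrite addn0 ball0 => /set1P->.
rewrite addnS !ballS in_setU [in X in _ -> X]in_setU => /orP[/IHj->//|/nbhdP[u /IHj ux uz]].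
by apply/orP; right; apply/nbhdP; exists u.
Qed.

Lemma ball_adj (G : sgraph) (x y : G) : adj x y -> y \in ball 1 x.
Proof. by move=> xy; rewrite ballS in_setU nbhd1 !inE xy orbT. Qed.

Lemma ball_sym (G : sgraph) (m : nat) (x y : G) : (y \in ball m x) = (x \in ball m y).
Proof.
have imp a b : b \in ball m a -> a \in ball m b; last by apply/idP/idP; apply: imp.
elim: m b => [|m IHm] b; first by rewrite !ball0 !in_set1 eq_sym.
rewrite {1}ballS in_setU => /orP[/IHm ab|/nbhdP[u /IHm au ub]].
  by rewrite ballS in_setU ab.
rewrite -add1n; apply: ball_trans au.
by apply: ball_adj; rewrite adj_sym.
Qed.

Lemma ball_path (G : sgraph) (x : G) (p : seq G) :
  path (@adj G) x p -> last x p \in ball (size p) x.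
Proof.
elim: p x => [|y p IHp] x /=; first by rewrite set11.
by move=> /andP[/ball_adj xy /IHp yp]; apply: (@ball_trans _ 1 (size p) x y).
Qed.

Lemma ball_power_adj (G : sgraph) (k : nat) (x y : G) :
  power_adj k x y -> y \in ball k x.
Proof.
move=> /and3P[_ /gdistP[/existsP[p /andP[pP /eqP py]] _] le].
rewrite -(subnKC le); apply: ball_trans (ball_center _ _).
by have := ball_path pP; rewrite size_tuple py.
Qed.

(** * The skeleton of a linked set *)

Definition captured (G : sgraph) (d : nat) (B : {set G}) : {set G} :=
  [set u | 3 * d <= 4 * #|[set y | adj u y] :&: B|]%N.

(** A vertex u of X with more than d/4 neighbours outside N(T) could be added to
    T without violating d|T| <= 4|N(T)|, so a maximal T captures all of X. *)
Lemma exists_skeleton (G : sgraph) (d : nat) (X : {set G}) (v : G) :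
  regular G d -> v \in X ->
  exists T : {set G}, [/\ v \in T, T \subset X, (d * #|T| <= 4 * #|nbhd T|)%N
    & X \subset captured d (nbhd T)].
Proof.
move=> rG vX.
pose P := [pred T : {set G} | [&& v \in T, T \subset X & d * #|T| <= 4 * #|nbhd T|]%N].
have Pv : P [set v].
  by rewrite /P /= set11 sub1set vX cards1 nbhd1 rG muln1 leq_pmull.
have [T /maxsetP[/and3P[vT TX dT] Tmax] _] := maxset_exists Pv.
exists T; split=> //; apply/subsetP=> u uX; rewrite inE leqNgt; apply/negP => few.
have eU : #|u |: T| = #|T|.
  have [uT|uT] := boolP (u \in T); first by rewrite (setUidPr _) ?sub1set.
  rewrite (Tmax (u |: T)) ?subsetUr //.
  rewrite /P /= inE vT orbT subUset sub1set uX TX /= nbhdU nbhd1 cardsU1 uT cardsU rG.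
  have le : (#|[set y | adj u y] :&: nbhd T| <= #|nbhd T|)%N.
    by rewrite subset_leq_card ?subsetIr.
  by lia.
move/eqP: eU; rewrite cardsU1 -[X in _ == X]add0n eqn_add2r eqb0 negbK => uT.
have /setIidPl uN : [set y | adj u y] \subset nbhd T.
  by rewrite -nbhd1 nbhdS // sub1set.
by move: few; rewrite uN rG; lia.
Qed.

Lemma captured_meets (G : sgraph) (d : nat) (T : {set G}) (u : G) :
  (0 < d)%N -> u \in captured d (nbhd T) -> exists2 t, t \in T & u \in ball 2 t.
Proof.
move=> d0; rewrite inE => le.
have /card_gt0P[y] : (0 < #|[set y | adj u y] :&: nbhd T|)%N by lia.
rewrite inE => /andP[]; rewrite inE => uy /nbhdP[t tT ty]; exists t => //.
by apply: (@ball_trans _ 1 1 _ y); apply: ball_adj; rewrite // adj_sym.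
Qed.

(** A path in X from v to b leaves the 2-neighbourhood of B along some step x, y
    of length at most k; going from B to x and from y to T costs 2 each, and the
    endpoint in T is outside B because y is far from B. *)
Lemma skeleton_linked (G : sgraph) (k : nat) (X T : {set G}) (v : G) :
  linked k X -> v \in X -> T \subset X ->
  (forall x, x \in X -> exists2 t, t \in T & x \in ball 2 t) ->
  forall B : {set G}, v \in B -> B \proper T ->
  exists2 a, a \in B & exists2 b, b \in T :\: B & b \in ball (k + 4) a.
Proof.
move=> /forall_inP lX vX /subsetP TX near B vB /properP[/subsetP BT [b bT bB]].
pose XB := [pred x | [exists a in B, x \in ball 2 a]].
have [bXB|bXB] := boolP (XB b).
  have /exists_inP[a aB ab] := bXB.
  exists a => //; exists b; first by rewrite inE bB.
  by rewrite -[(k + 4)%N]/(k + (2 + 2))%N addnCA; apply: ball_trans ab (ball_center _ _).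
have XBv : XB v by apply/exists_inP; exists v => //; apply: ball_center.
have /forall_inP/(_ _ (TX _ bT)) := lX _ vX.
move=> /connectP[p pP bE]; rewrite {}bE in bXB.
have [x [y [xXB yXB /and3P[xX yX xy]]]] : exists x y, [/\ XB x, ~~ XB y &
    [&& x \in X, y \in X & power_adj k x y]].
  elim: p {vB vX} v XBv pP bXB => [|y p IHp] x XBx /=; first by move=> _ /negP[].
  case/andP=> xy pP lp; have [yXB|yXB] := boolP (XB y); first exact: IHp yXB pP lp.
  by exists x, y.
have [a aB ax] := exists_inP xXB.
have [t tT ty] := near _ yX.
have tB : t \notin B by apply: contra yXB => tB; apply/exists_inP; exists t.
exists a => //; exists t; first by rewrite inE tB.
rewrite -[(k + 4)%N]/(k + (2 + 2))%N addnCA; apply: ball_trans ax _.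
by apply: ball_trans (ball_power_adj xy) _; rewrite ball_sym.
Qed.

Lemma path_nseq_refl (T : eqType) (e : rel T) (x : T) (j : nat) :
  e x x -> path e x (nseq j x).
Proof. by move=> exx; elim: j => //= j ->; rewrite exx. Qed.

(** The exponent (4g/d).*2 is a uniform bound for the length 2(|T| - 1) of the
    traversal of the skeleton T. *)
Lemma card_Hfam_le (G : sgraph) (d k g w : nat) (v : G) :
  regular G d -> (0 < d)%N ->
  (forall B : {set G}, #|B| <= g -> #|captured d B| <= w)%N ->
  (#|Hfam k v g| <= (d.+1 ^ (k + 4)) ^ (4 * g %/ d).*2 * 2 ^ w)%N.
Proof.
move=> rG d0 capw.
pose r := ball (G := G) (k + 4); pose m := (4 * g %/ d)%N.
apply: leq_trans (leq_mul (size_trails m.*2 v (fun y => card_ball (k + 4) y rG)) (leqnn _)).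
apply: (card_cover (W := fun s => captured d (nbhd [set x in v :: s]))).
move=> X; rewrite inE => /and3P[lX vX /eqP gX].
have [T [vT TX dT XT]] := exists_skeleton rG vX.
have Tg : (#|nbhd T| <= g)%N by rewrite -gX subset_leq_card ?nbhdS.
have near x : x \in X -> exists2 t, t \in T & x \in ball 2 t.
  by move=> /(subsetP XT); apply: captured_meets.
have [p [pP pT sp]] := covering_closed_walk (e := fun a b => b \in r a)
  (fun a b => ball_sym (k + 4) a b) vT (skeleton_linked lX vX TX near).
have pm : (size p <= m.*2)%N.
  have Tm : (#|T| <= m)%N by rewrite leq_divRL // mulnC; lia.
  by rewrite sp leq_double; lia.
(* Pad the traversal by resting at its endpoint, so that all codes have the
   same length. *)
pose q := p ++ nseq (m.*2 - size p) (last v p).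
have qT : [set x in v :: q] = T.
  rewrite -pT; apply/setP=> x; rewrite !inE mem_cat mem_nseq orbA.
  have [->|] := eqVneq x (last v p); last by rewrite andbF orbF.
  by rewrite -!in_cons mem_last.
exists q; last by rewrite qT; split=> //; apply: capw.
have <- : size q = m.*2 by rewrite size_cat size_nseq subnKC.
apply: mem_trails; rewrite cat_path pP path_nseq_refl //.
exact: ball_center.
Qed.

(** * Consequences of the mixing inequality *)

Lemma edge_count_sum (G : sgraph) (S T : {set G}) :
  edge_count S T = (\sum_(u in S) #|[set y | adj u y] :&: T|)%N.
Proof.
rewrite /edge_count -sum1_card.
under eq_bigl => p do rewrite inE.
rewrite -(pair_big_dep (mem S) (fun x y => (y \in T) && adj x y) (fun _ _ => 1%N)) /=.
apply: eq_bigr => u _; rewrite -sum1_card; apply: eq_bigl => y.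
by rewrite !inE andbC.
Qed.

(** The threshold 3d/4 in captured exceeds the average d|B|/n <= d/2 by d/4, and
    the mixing inequality forbids such a deviation on a large set. *)
Lemma card_captured (R : realType) (G : sgraph) (d : nat) (lambda : R) (B : {set G}) :
  expander G d lambda -> (0 < d)%N -> (#|B|%:R : R) <= #|G|%:R / 2 ->
  d%:R ^+ 2 * #|captured d B|%:R <= 16 * lambda ^+ 2 * #|B|%:R.
Proof.
move=> [rG eG] d0 Bn; set W := captured d B.
have [->|/card_gt0P[x0 x0W]] := posnP #|W|.
  by rewrite mulr0 mulr_ge0 // mulr_ge0 ?sqr_ge0.
have n0 : 0 < (#|G|%:R : R) by rewrite ltr0n; apply/card_gt0P; exists x0.
have Wp : 0 < (#|W|%:R : R) by rewrite ltr0n; apply/card_gt0P; exists x0.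
have D0 : 0 < (d%:R : R) by rewrite ltr0n.
have W0 : 0 <= (#|W|%:R : R) by [].
have B0 : 0 <= (#|B|%:R : R) by [].
have eW : 3 * d%:R * #|W|%:R <= 4 * (edge_count W B)%:R :> R.
  rewrite -!natrM ler_nat edge_count_sum big_distrr /= mulnC -sum_nat_const.
  by apply: leq_sum => u; rewrite inE.
have := eG W B; rewrite ler_norml => /andP[_].
have half : d%:R / #|G|%:R * #|W|%:R * #|B|%:R <= d%:R * #|W|%:R / 2 :> R.
  have -> : d%:R / #|G|%:R * #|W|%:R * #|B|%:R = d%:R * #|W|%:R * (#|B|%:R / #|G|%:R) :> R by ring.
  rewrite ler_wpM2l ?mulr_ge0 //.
  by rewrite ler_pdivrMr // mulrC.
set s := Num.sqrt _ => le.
have key : d%:R * #|W|%:R <= 4 * (lambda * s) by lra.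
have s2 : s ^+ 2 = #|W|%:R * #|B|%:R by rewrite sqr_sqrtr // mulr_ge0.
rewrite -(ler_pM2r Wp).
have := ler_pM (mulr_ge0 (ltW D0) W0) (mulr_ge0 (ltW D0) W0) key key.
have -> : 4 * (lambda * s) * (4 * (lambda * s)) = 16 * lambda ^+ 2 * s ^+ 2 by ring.
by rewrite s2; lra.
Qed.

(** Mixing inequality for a vertex and its neighbourhood: d edges, of which
    d^2/n <= d/2 are expected. *)
Lemma sqrt_degree_le (R : realType) (G : sgraph) (d : nat) (lambda : R) (v : G) :
  expander G d lambda -> (d%:R : R) <= #|G|%:R / 2 -> (0 < d)%N ->
  Num.sqrt d%:R <= 2 * lambda.
Proof.
move=> [rG eG] dn d0.
have n0 : 0 < (#|G|%:R : R) by rewrite ltr0n; apply/card_gt0P; exists v.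
have D0 : 0 < (d%:R : R) by rewrite ltr0n.
have := eG [set v] (nbhd [set v]).
rewrite edge_count_sum big_set1 nbhd1 setIid cards1 rG mulr1 mul1r.
rewrite ler_norml => /andP[_].
have half : d%:R / #|G|%:R * d%:R <= d%:R / 2 :> R.
  rewrite mulrAC -[leLHS]mulrA ler_wpM2l //.
  by rewrite ler_pdivrMr // mulrC.
have s0 : 0 < Num.sqrt (d%:R : R) by rewrite sqrtr_gt0.
have s2 : Num.sqrt d%:R * Num.sqrt d%:R = d%:R :> R by rewrite -expr2 sqr_sqrtr ?ltW.
move=> le; rewrite -(ler_pM2r s0) s2; lra.
Qed.

(** * The counting bound *)

Lemma card_connected_1regular (G : sgraph) (v : G) :
  gconnected G -> regular G 1 -> (#|G| <= 2)%N.
Proof.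
move=> cG rG.
have [w vw] : exists w, [set y | adj v y] = [set w] by apply/cards1P; rewrite rG.
have adj_vw : adj v w by have := set11 w; rewrite -vw inE.
have only (x y z : G) : adj x y -> adj x z -> z = y.
  move=> xy xz; have /eqP/cards1P[u xu] := rG x.
  have : y \in [set y | adj x y] by rewrite inE.
  have : z \in [set y | adj x y] by rewrite inE.
  by rewrite xu => /set1P-> /set1P->.
have cl : closed (@adj G) [set v; w].
  apply: intro_closed; first exact: (sym_connect_sym (@adj_sym G)).
  move=> x y xy /set2P[] xE; apply/set2P; rewrite xE in xy.
    by right; apply: only xy.
  by left; apply: only xy; rewrite adj_sym.
have -> : #|G| = #|[set v; w]|.
  by apply: eq_card => x; rewrite -(closed_connect cl (cG v x)) set21.
by rewrite cards2; case: eqP.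
Qed.

Theorem lemma3p1 (R : realType) :
  exists C : R, 0 < C /\
    forall (G : sgraph) (d : nat) (lambda : R) (k : nat) (v : G) (g : nat),
      gconnected G -> expander G d lambda -> (1 <= d)%N -> (1 <= k)%N ->
      (d <= g)%N -> (g%:R : R) <= #|G|%:R / 2 ->
      (#|Hfam k v g|%:R : R) <=
        expR (C * g%:R / d%:R *
              Num.max (k%:R * log2 (4 * lambda / Num.sqrt d%:R) * log2 d%:R)
                      (lambda ^+ 2 / d%:R)).
Proof.
exists 100; split=> // G d lambda k v g cG eG d0 k0 dg gn.
have rG := eG.1.
have D0 : 0 < (d%:R : R) by rewrite ltr0n.
have g0 : 0 < (g%:R : R) by rewrite ltr0n (leq_trans d0).
have dgR : (d%:R : R) <= g%:R by rewrite ler_nat.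
have dl := sqrt_degree_le v eG (le_trans dgR gn) d0.
have s0 : 0 < Num.sqrt (d%:R : R) by rewrite sqrtr_gt0.
have gd0 : 0 <= g%:R / d%:R :> R by rewrite divr_ge0.
set M := Num.max _ _.
have ML : lambda ^+ 2 / d%:R <= M by rewrite /M le_max lexx orbT.
have [d1|d1] := eqVneq d 1%N.
  subst d; rewrite sqrtr1 in dl; rewrite !divr1 in ML *.
  have n2 := card_connected_1regular v cG rG.
  (* There are at most 2^2 vertex sets, and the exponent is at least 100/4. *)
  have H4 : (#|Hfam k v g|%:R : R) <= 1 + 3.
    rewrite -[1 + 3]/(1%:R + 3%:R) -natrD ler_nat.
    apply: leq_trans (max_card _) _; rewrite -cardsT -powersetT card_powerset cardsT.
    by rewrite -[(1 + 3)%N]/(2 ^ 2)%N leq_exp2l.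
  apply: le_trans H4 (le_trans (expR_ge1Dx _) _); rewrite ler_expR.
  have : 1 / 4 <= M by nra.
  by nra.
have {}d1 : (1 < d)%N by lia.
have D1 : 1 < (d%:R : R) by rewrite ltr1n.
have ln2_gt0 : 0 < ln (2 : R) by rewrite ln_gt0 // ltr1n.
have ln2_le1 : ln (2 : R) <= 1.
  rewrite -[leRHS]expRK ler_ln ?posrE ?expR_gt0 //.
  by apply: le_trans (expR_ge1Dx 1).
have lnd0 : 0 <= ln (d%:R : R) by rewrite ln_ge0 ?ltW.
have lnd : ln (d%:R : R) <= log2 d%:R.
  by rewrite /log2 ler_pdivlMr // ler_piMr.
have lrat : 1 <= log2 (4 * lambda / Num.sqrt d%:R).
  have le2 : 2 <= 4 * lambda / Num.sqrt d%:R by rewrite ler_pdivlMr //; lra.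
  by rewrite /log2 ler_pdivlMr // mul1r ler_ln ?posrE // (lt_le_trans _ le2).
have MK : k%:R * ln (d%:R : R) <= M.
  rewrite /M le_max; apply/orP; left.
  rewrite -mulrA ler_wpM2l //; apply: (le_trans lnd).
  by apply: (ler_peMl _ lrat); apply: (le_trans lnd0).
pose omega := 16 * lambda ^+ 2 * g%:R / d%:R ^+ 2.
have om0 : 0 <= omega by rewrite /omega divr_ge0 ?sqr_ge0 // mulr_ge0 // mulr_ge0 ?sqr_ge0.
have capw (B : {set G}) : (#|B| <= g -> #|captured d B| <= Num.truncn omega)%N.
  move=> Bg; rewrite truncn_ge_nat // /omega ler_pdivlMr ?exprn_gt0 // mulrC.
  have BgR : (#|B|%:R : R) <= g%:R by rewrite ler_nat.
  apply: le_trans (card_captured eG d0 (le_trans BgR gn)) _.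
  by rewrite ler_wpM2l // mulr_ge0 ?sqr_ge0.
have := card_Hfam_le k v rG d0 capw.
set m := (4 * g %/ d)%N => Hle.
apply: (@le_trans _ _ (((d.+1 ^ (k + 4)) ^ m.*2 * 2 ^ Num.truncn omega)%N)%:R).
  by rewrite ler_nat.
have md : m%:R * d%:R <= 4 * g%:R :> R by rewrite -!natrM ler_nat leq_divM.
have m_le : m%:R <= 4 * (g%:R / d%:R) :> R by rewrite mulrA ler_pdivlMr.
have w_le : (Num.truncn omega)%:R <= omega by rewrite truncn_le.
have two : 2 <= expR (1 : R) by apply: le_trans (expR_ge1Dx 1).
have dS : (d.+1%:R : R) <= expR (2 * ln d%:R).
  rewrite expRM_natl lnK ?posrE // -natrX ler_nat; clear -d1; nia.
rewrite natrM !natrX -exprM.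
have e1 : d.+1%:R ^+ ((k + 4) * m.*2) <= expR (80 * (g%:R / d%:R) * (k%:R * ln d%:R)) :> R.
  apply: le_trans (_ : expR (2 * ln d%:R) ^+ ((k + 4) * m.*2) <= _).
    by rewrite lerXn2r ?nnegrE ?expR_ge0.
  rewrite -expRM_natl ler_expR.
  have k5 : ((k + 4) * m.*2)%:R <= 10 * k%:R * m%:R :> R.
    by rewrite -!natrM ler_nat; clear -k0; nia.
  apply: le_trans (_ : 10 * k%:R * m%:R * (2 * ln d%:R) <= _).
    by rewrite ler_wpM2r // mulr_ge0.
  have kl : 0 <= k%:R * ln (d%:R : R) by rewrite mulr_ge0.
  by have := ler_wpM2r kl m_le; lra.
have e2 : 2 ^+ Num.truncn omega <= expR omega.
  apply: le_trans (_ : expR 1 ^+ Num.truncn omega <= _).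
    by rewrite lerXn2r ?nnegrE ?expR_ge0.
  by rewrite -expRM_natl ler_expR mulr1.
apply: le_trans (ler_pM _ _ e1 e2) _; rewrite ?exprn_ge0 //.
rewrite -expRD ler_expR.
have -> : omega = 16 * (g%:R / d%:R) * (lambda ^+ 2 / d%:R).
  by rewrite /omega; field; rewrite gt_eqF.
rewrite -[100 * g%:R / d%:R]mulrA.
have := ler_wpM2l gd0 ML; have := ler_wpM2l gd0 MK.
have : 0 <= (g%:R / d%:R) * M.
  by rewrite mulr_ge0 // (le_trans _ ML) // divr_ge0 ?sqr_ge0.
by lra.
Qed.
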